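(* Let $n\ge 2$, and let $B(c_i,r_i)\subset\mathbb{R}^{n-1}$, $i=1,\dots,m$ ($m\ge 1$), be closed Euclidean balls with centers $c_i\in\mathbb{R}^{n-1}$ and radii $r_i\ge 0$. Let $\mathcal{P}=\{(r_i;c_i): i=1,\dots,m\}\subset\mathbb{R}^n$ and let $x^*=(x_0^*;\bar x^* )$ be the optimal solution of $Inf_{\mathcal{Q}}(\mathcal{P})$. (1) If $\bigcap_{i=1}^m B(c_i,r_i)=\emptyset$, then the ball of smallest radius that intersects every ball $B(c_i,r_i)$, $i=1,\dots,m$, is the ball with center $\bar x^*$ and radius $-x_0^*$. (2) If $\bigcap_{i=1}^m B(c_i,r_i)\neq\emptyset$, then $B(\bar x^*,x_0^* )$ is the ball of largest radius that is contained in $\bigcap_{i=1}^m B(c_i,r_i)$.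
   Context: Vectors of $\mathbb{R}^n$ are written $x=(x_0;\bar x)$ with $x_0\in\mathbb{R}$, $\bar x\in\mathbb{R}^{n-1}$. The second-order cone is $\mathcal{Q}=\{x\in\mathbb{R}^n:\ \|\bar x\|_2\le x_0\}$, and $x\preceq_{\mathcal{Q}} p$ means $p-x\in\mathcal{Q}$, i.e. $\|\bar p-\bar x\|\le p_0-x_0$. For a finite nonempty set $\mathcal{P}=\{p_1,\dots,p_m\}\subset\mathbb{R}^n$, $Inf_{\mathcal{Q}}(\mathcal{P})$ is the problem: maximize $x_0$ subject to $x\preceq_{\mathcal{Q}}p_i$ for $i=1,\dots,m$. Its optimal solution exists and is unique. $B(c,r)$ is the closed Euclidean ball in $\mathbb{R}^{n-1}$ with center $c$ and radius $r\ge0$. *)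

(* Defs.v *)
From mathcomp Require Import all_boot all_order all_algebra.
From mathcomp Require Import all_classical all_reals.

Set Implicit Arguments.
Unset Strict Implicit.
Unset Printing Implicit Defensive.

Import Order.TTheory GRing.Theory Num.Theory.

Local Open Scope classical_set_scope.
Local Open Scope ring_scope.

(* MathComp-Analysis norms matrices by the sup norm, so the Euclidean norm is
   defined here. *)
Definition enorm (R : realType) (d : nat) (v : 'rV[R]_d) : R :=
  Num.sqrt (\sum_(j < d) v ord0 j ^+ 2).

(* With r < 0 this set is empty; every use below requires 0 <= r. *)
Definition eball (R : realType) (d : nat) (c : 'rV[R]_d) (r : R) :
    set 'rV[R]_d :=
  [set y | enorm (y - c) <= r].

(* A vector (x_0; xbar) of R^n is a row of width 1 + (n - 1). *)
Definition vhead (R : realType) (d : nat) (x : 'rV[R]_(1 + d)) : R :=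
  lsubmx x ord0 ord0.

Definition vtail (R : realType) (d : nat) (x : 'rV[R]_(1 + d)) : 'rV[R]_d :=
  rsubmx x.

Definition vpair (R : realType) (d : nat) (a : R) (v : 'rV[R]_d) :
    'rV[R]_(1 + d) :=
  row_mx a%:M v.

Definition soc (R : realType) (d : nat) : set 'rV[R]_(1 + d) :=
  [set x | enorm (vtail x) <= vhead x].

Definition soc_le (R : realType) (d : nat) (x p : 'rV[R]_(1 + d)) : Prop :=
  soc (p - x).

Definition infQ_feasible (R : realType) (d : nat) (P : set 'rV[R]_(1 + d)) :
    set 'rV[R]_(1 + d) :=
  [set x | forall p, P p -> soc_le x p].

Definition infQ_optimal (R : realType) (d : nat) (P : set 'rV[R]_(1 + d))
    (x : 'rV[R]_(1 + d)) : Prop :=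
  infQ_feasible P x /\ forall y, infQ_feasible P y -> vhead y <= vhead x.

(* The ball B(c, r) is the one of smallest (resp. largest) radius among the
   balls B with property F: the radius is extremal, and no other center
   achieves it. *)
Definition is_the_smallest_ball (R : realType) (d : nat)
    (F : set 'rV[R]_d -> Prop) (c : 'rV[R]_d) (r : R) : Prop :=
  [/\ 0 <= r,
      F (eball c r),
      forall b s, 0 <= s -> F (eball b s) -> r <= s
    & forall b, F (eball b r) -> b = c].

Definition is_the_largest_ball (R : realType) (d : nat)
    (F : set 'rV[R]_d -> Prop) (c : 'rV[R]_d) (r : R) : Prop :=
  [/\ 0 <= r,
      F (eball c r),
      forall b s, 0 <= s -> F (eball b s) -> s <= r
    & forall b, F (eball b r) -> b = c].

(* Main.v *)
Require Import Defs.
From mathcomp Require Import all_boot all_order all_algebra.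
From mathcomp Require Import all_classical all_reals.
From mathcomp Require Import ring lra.

Set Implicit Arguments.
Unset Strict Implicit.
Unset Printing Implicit Defensive.

Import Order.TTheory GRing.Theory Num.Theory.

Local Open Scope classical_set_scope.
Local Open Scope ring_scope.

(** In the coordinates (s; b), feasibility for the cone problem says
    |b - c_i| + s <= r_i for every i.  For s >= 0 this means that B(b, s) lies
    in every B(c_i, r_i): when the dimension is positive, the point of B(b, s)
    farthest from c_i is at distance |b - c_i| + s.  For s <= 0 it means that
    B(b, -s) meets every B(c_i, r_i), since two balls meet exactly when the
    distance of their centers is at most the sum of their radii.  Hence
    maximizing s maximizes the radius of an inscribed ball and minimizes the
    radius of an intersecting one, and s = 0 is feasible exactly when the
    balls have a common point, which decides the sign of the optimal value.
    These equivalences are [eball_subsetP], [eball_meetP] and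
    [infQ_feasibleP].  The center is unique by strict convexity of the
    Euclidean norm: the midpoint of two optimal centers would leave room for
    a larger s ([infQ_optimal_center_unique]). *)

(** * The Euclidean norm *)

Section EuclideanNorm.
Variables (R : realType) (d : nat).
Implicit Types (u v w : 'rV[R]_d) (a s : R).

Lemma enorm_ge0 v : 0 <= enorm v.
Proof. exact: sqrtr_ge0. Qed.

Lemma enorm_sqr v : enorm v ^+ 2 = \sum_(j < d) v ord0 j ^+ 2.
Proof. by rewrite sqr_sqrtr// sumr_ge0// => j _; exact: sqr_ge0. Qed.

Lemma enormZ a v : enorm (a *: v) = `|a| * enorm v.
Proof.
rewrite /enorm -sqrtr_sqr -sqrtrM ?sqr_ge0//; congr Num.sqrt.
by rewrite mulr_sumr; apply: eq_bigr => j _; rewrite mxE exprMn.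
Qed.

Lemma enormN v : enorm (- v) = enorm v.
Proof. by rewrite -scaleN1r enormZ normrN1 mul1r. Qed.

Lemma enorm_distC u v : enorm (u - v) = enorm (v - u).
Proof. by rewrite -enormN opprB. Qed.

Lemma enorm0 : enorm (0 : 'rV[R]_d) = 0.
Proof. by rewrite -(scale0r 0) enormZ normr0 mul0r. Qed.

Lemma enorm_eq0 v : enorm v = 0 -> v = 0.
Proof.
move=> v0; have := enorm_sqr v; rewrite v0 expr0n/= => /esym/psumr_eq0P h.
apply/rowP => j; apply/eqP; rewrite mxE -sqrf_eq0; apply/eqP.
by apply: h => // k _; exact: sqr_ge0.
Qed.

(** Cauchy-Schwarz, from the nonnegativity of the squared norm of
    |v|^2 u - <u, v> v. *)
Lemma cauchy_schwarz u v :
  (\sum_(j < d) u ord0 j * v ord0 j) ^+ 2 <= enorm u ^+ 2 * enorm v ^+ 2.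
Proof.
set C := \sum_(j < d) _.
have [v0|v0] := eqVneq (enorm v) 0.
  suff -> : C = 0 by rewrite v0 expr0n mulr0.
  by apply: big1 => j _; rewrite (enorm_eq0 v0) mxE mulr0.
have B0 : 0 < enorm v ^+ 2 by rewrite exprn_gt0// lt_def v0 enorm_ge0.
rewrite -subr_ge0 -(pmulr_rge0 _ B0).
suff -> : enorm v ^+ 2 * (enorm u ^+ 2 * enorm v ^+ 2 - C ^+ 2) =
    enorm (enorm v ^+ 2 *: u - C *: v) ^+ 2 by exact: sqr_ge0.
rewrite [RHS]enorm_sqr.
transitivity (\sum_(j < d) ((enorm v ^+ 2) ^+ 2 * u ord0 j ^+ 2
    + (- (enorm v ^+ 2 * C *+ 2) * (u ord0 j * v ord0 j)
    + C ^+ 2 * v ord0 j ^+ 2))).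
  by rewrite !big_split/= -!mulr_sumr -/C -!enorm_sqr; ring.
by apply: eq_bigr => j _; rewrite !mxE; ring.
Qed.

Lemma ler_enormD u v : enorm (u + v) <= enorm u + enorm v.
Proof.
have u0 := enorm_ge0 u; have v0 := enorm_ge0 v.
rewrite -ler_sqr ?nnegrE ?enorm_ge0 ?addr_ge0// enorm_sqr.
have -> : \sum_(j < d) (u + v) ord0 j ^+ 2 = enorm u ^+ 2 +
    ((\sum_(j < d) u ord0 j * v ord0 j) *+ 2 + enorm v ^+ 2).
  rewrite !enorm_sqr -sumrMnl -!big_split/=.
  by apply: eq_bigr => j _; rewrite !mxE; ring.
have : \sum_(j < d) u ord0 j * v ord0 j <= enorm u * enorm v.
  apply: le_trans (ler_norm _) _.
  rewrite -ler_sqr ?nnegrE ?mulr_ge0// exprMn real_normK ?num_real//.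
  exact: cauchy_schwarz.
by move: (\sum_(j < d) _) => C; lra.
Qed.

Lemma ler_enorm_dist w u v : enorm (u - v) <= enorm (u - w) + enorm (w - v).
Proof. by apply: le_trans (ler_enormD _ _); rewrite addrA subrK. Qed.

(** The parallelogram law, in the form that measures the strict convexity of
    the squared norm. *)
Lemma enorm_midpoint_sqr u v :
  enorm (2^-1 *: (u + v)) ^+ 2 =
  (enorm u ^+ 2 + enorm v ^+ 2) / 2 - enorm (u - v) ^+ 2 / 4.
Proof.
rewrite !enorm_sqr -big_split/= !mulr_suml -sumrB.
by apply: eq_bigr => j _; rewrite !mxE; field.
Qed.

End EuclideanNorm.

(** * Balls and the second-order cone *)

Section Balls.
Variables (R : realType) (d : nat).
Implicit Types (b c : 'rV[R]_d) (r s : R).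

(** The witness for the converse divides the segment from b to c in the ratio
    s : r. *)
Lemma eball_meetP b c r s : 0 <= s -> 0 <= r ->
  eball b s `&` eball c r !=set0 <-> enorm (b - c) <= r + s.
Proof.
move=> s0 r0; rewrite /eball; split=> [[y [/= yb yc]]|bc].
  by have := ler_enorm_dist y b c; rewrite (enorm_distC b y); lra.
have [rs0|rs0] := eqVneq (r + s) 0.
  exists b; split; rewrite /= ?subrr ?enorm0//.
  by apply: le_trans bc _; lra.
have rs_gt0 : 0 < r + s by rewrite lt_def rs0 addr_ge0.
have shrink t : 0 <= t -> `|t / (r + s)| * enorm (b - c) <= t.
  move=> t0; rewrite ger0_norm; last by rewrite divr_ge0// ltW.
  by rewrite mulrAC ler_pdivrMr// ler_wpM2l.
exists (b + (s / (r + s)) *: (c - b)); split => /=.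
  by rewrite addrAC subrr add0r enormZ enorm_distC shrink.
have -> : b + (s / (r + s)) *: (c - b) - c = (r / (r + s)) *: (b - c).
  by apply/rowP => j; rewrite !mxE; field.
by rewrite enormZ shrink.
Qed.

(** The point of B(b, s) farthest from c lies on the ray from c through b, or
    in any direction if b = c; such a direction exists only in positive
    dimension. *)
Lemma eball_subsetP b c r s : (0 < d)%N -> 0 <= s ->
  eball b s `<=` eball c r <-> enorm (b - c) + s <= r.
Proof.
rewrite /eball => d0 s0; split=> [sub|bcs y /= yb]; last first.
  by have := ler_enorm_dist b y c; lra.
have [e e1 bce] : exists2 e : 'rV[R]_d, enorm e = 1
    & b - c = enorm (b - c) *: e.
  have [bc|bc] := eqVneq (enorm (b - c)) 0.
    exists (delta_mx ord0 (Ordinal d0)); last first.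
      by rewrite bc scale0r; exact: enorm_eq0.
    rewrite /enorm (bigD1 (Ordinal d0))//= big1 => [|j /negbTE jd].
      by rewrite mxE !eqxx expr1n addr0 sqrtr1.
    by rewrite mxE jd andbF expr0n.
  exists ((enorm (b - c))^-1 *: (b - c)).
    by rewrite enormZ ger0_norm ?invr_ge0 ?enorm_ge0// mulVf.
  by rewrite scalerA divff// scale1r.
have : enorm (b + s *: e - c) <= r.
  by apply: sub; rewrite /= addrAC subrr add0r enormZ e1 mulr1 ger0_norm.
rewrite addrAC {1}bce -scalerDl enormZ e1 mulr1 ger0_norm//.
by rewrite addr_ge0 ?enorm_ge0.
Qed.

Lemma vpair_headtail (x : 'rV[R]_(1 + d)) : vpair (vhead x) (vtail x) = x.
Proof.
rewrite -[RHS]hsubmxK; congr row_mx.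
by apply/matrixP => i j; rewrite !ord1 mxE eqxx mulr1n.
Qed.

Lemma vhead_vpair s b : vhead (vpair s b) = s.
Proof. by rewrite /vhead row_mxKl mxE eqxx mulr1n. Qed.

Lemma soc_le_vpairP s b r c :
  soc_le (vpair s b) (vpair r c) <-> enorm (b - c) + s <= r.
Proof.
rewrite /soc_le /soc /vpair /= opp_row_mx add_row_mx.
rewrite /vtail /vhead row_mxKr row_mxKl !mxE eqxx !mulr1n enorm_distC.
by rewrite lerBrDr.
Qed.

End Balls.

Section Infimum.
Variables (R : realType) (d m : nat) (c : 'I_m -> 'rV[R]_d) (r : 'I_m -> R).

Let P := [set vpair (r i) (c i) | i in [set: 'I_m]].

Lemma infQ_feasibleP s b :
  infQ_feasible P (vpair s b) <-> forall i, enorm (b - c i) + s <= r i.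
Proof.
split=> [h i|h _ [i _ <-]]; last exact/soc_le_vpairP.
by apply/soc_le_vpairP/h; exists i.
Qed.

Lemma infQ_optimal_feasible x : infQ_optimal P x ->
  forall i, enorm (vtail x - c i) + vhead x <= r i.
Proof. by move=> [xP _]; apply/infQ_feasibleP; rewrite vpair_headtail. Qed.

Lemma infQ_optimal_ge x s b : infQ_optimal P x ->
  (forall i, enorm (b - c i) + s <= r i) -> s <= vhead x.
Proof.
by move=> [_ xmax] /infQ_feasibleP/xmax; rewrite vhead_vpair.
Qed.

(** At the midpoint of two optimal centers at distance e, each constraint
    |b - c_i| <= r_i - x_0 improves to the square root of
    (r_i - x_0)^2 - e^2 / 4, so x_0 can be raised by a positive amount that is
    uniform in i. *)
Lemma infQ_optimal_center_unique x b : infQ_optimal P x ->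
  (forall i, enorm (b - c i) + vhead x <= r i) -> b = vtail x.
Proof.
move=> xopt hb; have hx := infQ_optimal_feasible xopt.
apply/eqP; rewrite -subr_eq0; apply: contraT => bx.
pose delta := enorm (b - vtail x) ^+ 2 / 4.
have delta_gt0 : 0 < delta.
  rewrite divr_gt0// exprn_gt0// lt_def enorm_ge0 andbT.
  by apply: contra bx => /eqP/enorm_eq0 ->.
pose t i := r i - vhead x.
have t_ge0 i : 0 <= t i.
  by have := hb i; have := enorm_ge0 (b - c i); rewrite /t; lra.
(* The summand 1 only makes the upper bound of the t i positive. *)
pose T := 1 + \sum_i t i.
have T_gt0 : 0 < T by rewrite ltr_pwDl// sumr_ge0.
have le_tT i : t i <= T.
  rewrite /T (bigD1 i)//= addrCA lerDl.
  by apply: addr_ge0 => //; apply: sumr_ge0.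
pose eps := delta / (2 * T).
have eps_gt0 : 0 < eps by rewrite divr_gt0// mulr_gt0.
have epsT : 2 * T * eps = delta by rewrite /eps mulrC divfK// gt_eqF ?mulr_gt0.
suff : vhead x + eps <= vhead x by rewrite gerDl leNgt eps_gt0.
apply: (@infQ_optimal_ge x _ (2^-1 *: (b + vtail x))) => // i.
suff : enorm (2^-1 *: (b + vtail x) - c i) <= t i - eps by rewrite /t; lra.
have -> : 2^-1 *: (b + vtail x) - c i =
    2^-1 *: ((b - c i) + (vtail x - c i)).
  by apply/rowP => j; rewrite !mxE; field.
set z := 2^-1 *: _.
have zle : enorm z ^+ 2 <= t i ^+ 2 - delta.
  rewrite enorm_midpoint_sqr opprB addrA subrK -/delta.
  have sq w : enorm (w - c i) + vhead x <= r i ->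
      enorm (w - c i) ^+ 2 <= t i ^+ 2.
    by move=> h; rewrite ler_sqr ?nnegrE ?enorm_ge0 ?t_ge0// /t; lra.
  by have := sq _ (hb i); have := sq _ (hx i); lra.
have teps : 2 * t i * eps <= delta.
  rewrite -epsT; apply: ler_wpM2r; first exact: ltW.
  exact: ler_wpM2l.
have eps_le_t : eps <= t i.
  (* Otherwise t_i < eps; since delta <= t_i^2 and t_i <= T, this gives
     2 T eps <= t_i^2 <= T eps with T eps > 0. *)
  rewrite leNgt; apply/negP => tlt.
  have tt : t i ^+ 2 <= T * eps.
    by rewrite expr2; apply: ler_pM => //; exact: ltW.
  have Te : 0 < T * eps by rewrite mulr_gt0.
  by have := sqr_ge0 (enorm z); lra.
rewrite -ler_sqr ?nnegrE ?enorm_ge0 ?subr_ge0//.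
by have := sqr_ge0 eps; lra.
Qed.

End Infimum.

(** * The extremal balls *)

Theorem mainTheorem2 (R : realType) (n m : nat) (hn : (2 <= n)%N)
    (hm : (1 <= m)%N) (c : 'I_m -> 'rV[R]_(n.-1)) (r : 'I_m -> R)
    (hr : forall i, 0 <= r i) (x : 'rV[R]_(1 + n.-1))
    (hx : infQ_optimal [set vpair (r i) (c i) | i in [set: 'I_m]] x) :
  (\bigcap_(i in [set: 'I_m]) eball (c i) (r i) = set0 ->
     is_the_smallest_ball
       (fun B => forall i, B `&` eball (c i) (r i) !=set0)
       (vtail x) (- vhead x))
  /\
  (\bigcap_(i in [set: 'I_m]) eball (c i) (r i) !=set0 ->
     is_the_largest_ball
       (fun B => B `<=` \bigcap_(i in [set: 'I_m]) eball (c i) (r i))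
       (vtail x) (vhead x)).
Proof.
have d_gt0 : (0 < n.-1)%N by rewrite -subn1 subn_gt0.
have xfeas := infQ_optimal_feasible hx.
split=> [cap0|[y capy]].
- have x0 : vhead x < 0.
    rewrite ltNge; apply/negP => x0.
    have : (\bigcap_(i in [set: 'I_m]) eball (c i) (r i)) (vtail x).
      by move=> i _; have := xfeas i; rewrite /eball/=; lra.
    by rewrite cap0.
  have x0' : 0 <= - vhead x by lra.
  have meet b s : 0 <= s ->
      (forall i, eball b s `&` eball (c i) (r i) !=set0) ->
      forall i, enorm (b - c i) + - s <= r i.
    by move=> s0 h i; have /eball_meetP := h i; move=> /(_ s0 (hr i)); lra.
  split=> //.
  + by move=> i; apply/eball_meetP => //; have := xfeas i; lra.
  + by move=> b s s0 /(meet _ _ s0)/(infQ_optimal_ge hx); lra.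
  + move=> b /(meet _ _ x0') h; apply: (infQ_optimal_center_unique hx) => i.
    by rewrite -[vhead x]opprK.
- have x0 : 0 <= vhead x.
    apply: (infQ_optimal_ge (b := y) hx) => i; rewrite addr0.
    exact: capy.
  have sub b s : 0 <= s ->
      eball b s `<=` \bigcap_(i in [set: 'I_m]) eball (c i) (r i) ->
      forall i, enorm (b - c i) + s <= r i.
    by move=> s0 h i; apply/eball_subsetP => // z /h; exact.
  split=> //.
  + move=> z zx i _; move: z zx; apply/eball_subsetP => //; exact: xfeas.
  + by move=> b s s0 /(sub _ _ s0)/(infQ_optimal_ge hx).
  + by move=> b /(sub _ _ x0)/(infQ_optimal_center_unique hx).
Qed.
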